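(* Let $\mathbb{F}$ be either $\mathbb{Q}$ or $\mathbb{Z}_q$ for a prime $q$, and fix a Frege proof system. The non-commutative IPS over $\mathbb{F}$, with refutations written as non-commutative formulas, polynomially simulates Frege: there is a polynomial $p$ such that for every propositional tautology $T$ in variables $x_1,\dots,x_n$, if $T$ has a Frege proof of size $S$, then there is a non-commutative IPS certificate over $\mathbb{F}$ refuting the system consisting of the single equation $\mathrm{tr}(\neg T)=0$ (together with the Boolean and commutator axioms) whose non-commutative formula size is at most $p(S)$. In particular, if $T$ has a polynomial-size Frege proof then such a certificate of polynomial non-commutative formula size exists.
   Context: A Frege proof system is a propositional proof system with finitely many sound axiom schemes and inference rules (each rule $\frac{A_1,\dots,A_k}{A_0}$ applied via substitution instances), implicationally complete, whose lines are Boolean formulas over $\lor,\land,\neg$; the size of a proof is the total size of its formulas. A non-commutative formula over $\mathbb{F}$ is a fan-in-two rooted tree whose leaves are labeled by variables or field elements and whose internal nodes are $+$ or $\times$ gates, with the children of each $\times$ gate ordered; it computes a polynomial in the free algebra $\mathbb{F}\langle x_1,x_2,\dots\rangle$ (non-commuting variables). Its size is its number of nodes. Translation $\mathrm{tr}$: $\mathrm{tr}(x_i)=x_i$, $\mathrm{tr}(\mathsf{false})=1$, $\mathrm{tr}(\mathsf{true})=0$, $\mathrm{tr}(\neg T_1)=1-\mathrm{tr}(T_1)$, $\mathrm{tr}(T_1\lor T_2)=\mathrm{tr}(T_1)\cdot\mathrm{tr}(T_2)$, $\mathrm{tr}(T_1\land T_2)=1-(1-\mathrm{tr}(T_1))\cdot(1-\mathrm{tr}(T_2))$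 (so $0$ represents true). Non-commutative IPS: given non-commutative polynomials $F_1,\dots,F_m\in\mathbb{F}\langle x_1,\dots,x_n\rangle$ that include the Boolean axioms $x_i(1-x_i)$ ($1\le i\le n$) and the commutator axioms $x_ix_j-x_jx_i$ ($1\le i<j\le n$) and have no common $0$-$1$ solution, a certificate (refutation) is a non-commutative polynomial $\mathfrak{F}(\bar x,y_1,\dots,y_m)\in\mathbb{F}\langle\bar x,\bar y\rangle$ with $\mathfrak{F}(\bar x,\bar 0)=0$ and $\mathfrak{F}(\bar x,F_1(\bar x),\dots,F_m(\bar x))=1$ as identities in $\mathbb{F}\langle \bar x\rangle$. Its size is the minimal size of a non-commutative formula computing it. *)

(* Defs.v *)
From mathcomp Require Import all_boot all_order all_algebra.
From Stdlib Require List.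
Set Implicit Arguments. Unset Strict Implicit. Unset Printing Implicit Defensive.
Import GRing.Theory.
Local Open Scope ring_scope.

Inductive form : Type :=
| PVar of nat | PTrue | PFalse
| PNot of form | POr of form & form | PAnd of form & form.

Fixpoint feval (a : nat -> bool) (f : form) : bool :=
  match f with
  | PVar i => a i | PTrue => true | PFalse => false
  | PNot g => ~~ feval a g
  | POr g h => feval a g || feval a h
  | PAnd g h => feval a g && feval a h
  end.

Fixpoint fsize (f : form) : nat :=
  match f with
  | PVar _ | PTrue | PFalse => 1%N
  | PNot g => (fsize g).+1
  | POr g h | PAnd g h => (fsize g + fsize h).+1
  end.

Fixpoint fsubst (s : nat -> form) (f : form) : form :=
  match f with
  | PVar i => s i | PTrue => PTrue | PFalse => PFalse
  | PNot g => PNot (fsubst s g)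
  | POr g h => POr (fsubst s g) (fsubst s h)
  | PAnd g h => PAnd (fsubst s g) (fsubst s h)
  end.

Fixpoint fvars_below (n : nat) (f : form) : bool :=
  match f with
  | PVar i => (i < n)%N | PTrue | PFalse => true
  | PNot g => fvars_below n g
  | POr g h | PAnd g h => fvars_below n g && fvars_below n h
  end.

Definition tautology (f : form) : Prop := forall a, feval a f.

(* A rule (A_1,...,A_k ; A_0) is a pair (premises, conclusion); axioms have k = 0. *)
Definition rule := (seq form * form)%type.

Definition derivation (rules : seq rule) (hyps : seq form) (ls : seq form) : Prop :=
  forall k, (k < size ls)%N ->
    List.In (nth PTrue ls k) hyps \/
    exists (r : rule) (s : nat -> form),
      List.In r rules /\ fsubst s r.2 = nth PTrue ls k /\
      forall A, List.In A r.1 ->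
        exists j, (j < k)%N /\ nth PTrue ls j = fsubst s A.

Definition derives (rules : seq rule) (hyps : seq form) (ls : seq form) (B : form) : Prop :=
  ls <> [::] /\ derivation rules hyps ls /\ last PTrue ls = B.

Definition rule_sound (r : rule) : Prop :=
  forall a, (forall A, List.In A r.1 -> feval a A) -> feval a r.2.

Definition implicationally_complete (rules : seq rule) : Prop :=
  forall (hyps : seq form) (B : form),
    (forall a, (forall A, List.In A hyps -> feval a A) -> feval a B) ->
    exists ls, derives rules hyps ls B.

Record frege_system := FregeSystem {
  frege_rules : seq rule;
  frege_sound : forall r, List.In r frege_rules -> rule_sound r;
  frege_complete : implicationally_complete frege_rules }.

Definition frege_proof (P : frege_system) (ls : seq form) (T : form) : Prop :=
  derives (frege_rules P) [::] ls T.

Definition proof_size (ls : seq form) : nat := sumn (map fsize ls).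

Inductive ncf (R : Type) (V : Type) : Type :=
| NVar of V | NConst of R | NAdd of ncf R V & ncf R V | NMul of ncf R V & ncf R V.
Arguments NVar {R V}. Arguments NConst {R V}.
Arguments NAdd {R V}. Arguments NMul {R V}.

Fixpoint ncsize {R V} (f : ncf R V) : nat :=
  match f with
  | NVar _ | NConst _ => 1%N
  | NAdd g h | NMul g h => (ncsize g + ncsize h).+1
  end.

(* The polynomial in R<V> computed by a formula, given by its coefficient on
   each word (monomial) w in the free monoid over V; the product is the
   concatenation (Cauchy) product of the free algebra. *)
Fixpoint nccoef {R : nzRingType} {V : eqType} (f : ncf R V) (w : seq V) : R :=
  match f with
  | NVar v => if w == [:: v] then 1 else 0
  | NConst c => if w == [::] then c else 0
  | NAdd g h => nccoef g w + nccoef h w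
  | NMul g h => \sum_(k < (size w).+1) nccoef g (take k w) * nccoef h (drop k w)
  end.

Definition nceq {R : nzRingType} {V : eqType} (f g : ncf R V) : Prop :=
  forall w, nccoef f w = nccoef g w.

Fixpoint ncsubst {R V W} (s : V -> ncf R W) (f : ncf R V) : ncf R W :=
  match f with
  | NVar v => s v
  | NConst c => NConst c
  | NAdd g h => NAdd (ncsubst s g) (ncsubst s h)
  | NMul g h => NMul (ncsubst s g) (ncsubst s h)
  end.

Fixpoint ncvars {R V} (P : V -> bool) (f : ncf R V) : bool :=
  match f with
  | NVar v => P v
  | NConst _ => true
  | NAdd g h | NMul g h => ncvars P g && ncvars P h
  end.

(* ---------------- Translation tr (0 represents true) *)
Definition ncone_minus {R : nzRingType} {V} (f : ncf R V) : ncf R V :=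
  NAdd (NConst 1) (NMul (NConst (-1)) f).

Fixpoint tr {R : nzRingType} (f : form) : ncf R nat :=
  match f with
  | PVar i => NVar i
  | PFalse => NConst 1
  | PTrue => NConst 0
  | PNot g => ncone_minus (tr g)
  | POr g h => NMul (tr g) (tr h)
  | PAnd g h => ncone_minus (NMul (ncone_minus (tr g)) (ncone_minus (tr h)))
  end.

(* The axioms: tr(~T), the Boolean axioms x_i(1-x_i) (i < n) and the
   commutator axioms x_i x_j - x_j x_i (i < j < n).  Variables x_1..x_n of
   the paper are indexed 0..n-1 here. *)
Definition bool_axioms {R : nzRingType} (n : nat) : seq (ncf R nat) :=
  [seq NMul (NVar i) (ncone_minus (NVar i)) | i <- iota 0 n].

Definition comm_axioms {R : nzRingType} (n : nat) : seq (ncf R nat) :=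
  [seq NAdd (NMul (NVar ij.1) (NVar ij.2))
            (NMul (NConst (-1)) (NMul (NVar ij.2) (NVar ij.1)))
  | ij <- [seq ij <- [seq (i, j) | i <- iota 0 n, j <- iota 0 n] | (ij.1 < ij.2)%N]].

Definition ips_axioms {R : nzRingType} (n : nat) (T : form) : seq (ncf R nat) :=
  tr (PNot T) :: bool_axioms n ++ comm_axioms n.

(* Non-commutative IPS certificate: a formula in the variables x_i (inl i,
   i < n) and y_j (inr j, j < m) computing a polynomial Phi with
   Phi(x, 0) = 0 and Phi(x, F_1(x), ..., F_m(x)) = 1 in R<x>. *)
Definition nc_ips_certificate {R : nzRingType} (n : nat) (axs : seq (ncf R nat))
    (Phi : ncf R (nat + nat)) : Prop :=
  ncvars (fun v => match v with inl i => (i < n)%N | inr j => (j < size axs)%N end) Phi /\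
  nceq (ncsubst (fun v => match v with inl i => NVar i | inr _ => NConst 0 end) Phi)
       (NConst 0) /\
  nceq (ncsubst (fun v => match v with inl i => NVar i | inr j => nth (NConst 0) axs j end) Phi)
       (NConst 1).

Definition nc_ips_psimulates (R : nzRingType) (P : frege_system) : Prop :=
  exists c d : nat,
    forall (n : nat) (T : form) (ls : seq form),
      fvars_below n T -> tautology T -> frege_proof P ls T ->
      exists Phi : ncf R (nat + nat),
        (ncsize Phi <= c * (proof_size ls).+1 ^ d)%N /\
        nc_ips_certificate n (ips_axioms n T) Phi.

(* Main.v *)
Require Import Defs.
From mathcomp Require Import all_boot all_order all_algebra.
From mathcomp Require Import zify.
From Stdlib Require List.
Set Implicit Arguments. Unset Strict Implicit. Unset Printing Implicit Defensive.
Import GRing.Theory.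
Local Open Scope ring_scope.

(* Let A_1, ..., A_m be the lines of the proof, a_k = tr(A_k) and
   E_k = (1 - a_1) ... (1 - a_k).  Then 1 - E_m is the telescoping sum of the
   E_k a_(k+1), while E_m = E_(m-1) (1 - a_m) is a left multiple of the axiom
   tr(~T), so it suffices to find a short certificate of each E_k a_(k+1) from
   the Boolean and commutator axioms alone.  If A_(k+1) is inferred from earlier
   lines A_j, each E_k a_j has one (move the factor 1 - a_j next to a_j), which
   reduces E_k a_(k+1) to an instance of one of the finitely many tautologies
   "the premises of a rule imply its conclusion"; Shannon expansion over the
   boundedly many variables of the rule certifies such an instance.  Each
   certificate is used only once, so the dag-like proof never has to be made
   tree-like. *)

(** * Polynomial identities by evaluation in algebras *)

Section Evaluation.
Variable R : comNzRingType.

(** Evaluating in an arbitrary algebra turns identities of the free algebra into ring identities,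
    which rewriting can settle. *)
Fixpoint ncev (V : Type) (A : algType R) (s : V -> A) (f : ncf R V) : A :=
  match f with
  | NVar v => s v
  | NConst c => c%:A
  | NAdd g h => ncev s g + ncev s h
  | NMul g h => ncev s g * ncev s h
  end.

Lemma ncev_subst (V W : Type) (A : algType R) (s : W -> A) (t : V -> ncf R W) f :
  ncev s (ncsubst t f) = ncev (fun v => ncev s (t v)) f.
Proof. by elim: f => //= g -> h ->. Qed.

Lemma eq_ncev (V : Type) (A : algType R) (s t : V -> A) :
  s =1 t -> ncev s =1 ncev t.
Proof. by move=> st; elim=> //= g -> h ->. Qed.

Section WordMatrix.
Variables (V : eqType) (w : seq V).
Let segment i j := take (j - i) (drop i w).

(** Rows and columns are the cut positions of [w]. As in an incidence algebra, the matrix product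
    composes adjacent factors of [w]. *)
Definition word_mx (f : ncf R V) : 'M[R]_((size w).+1) :=
  \matrix_(i, j) if (i <= j)%N then nccoef f (segment i j) else 0.

Lemma size_segment (i j : nat) :
  (i <= j)%N -> (j <= size w)%N -> size (segment i j) = (j - i)%N.
Proof.
move=> ij jw; rewrite size_take size_drop; case: ltnP => // H.
by apply/eqP; rewrite eqn_leq H leq_sub2r.
Qed.

Lemma word_mx_mul (g h : ncf R V) :
  word_mx (NMul g h) = word_mx g * word_mx h.
Proof.
apply/matrixP=> i j; rewrite !mxE.
under [RHS]eq_bigr => k _ do rewrite !mxE.
pose F k := (if (i <= k)%N then nccoef g (segment i k) else 0) *
            (if (k <= j)%N then nccoef h (segment k j) else 0).
rewrite -(big_mkord xpredT F).
case: leqP => ij; last first.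
  rewrite big1_seq // => k _; rewrite /F.
  case: leqP => ik; rewrite ?mul0r //.
  by rewrite leqNgt (leq_trans ij ik) mulr0.
have jw : (j <= size w)%N by rewrite -ltnS.
(* Only cuts [k] with [i <= k <= j] contribute; shifted by [i], they are the splittings in the
   Cauchy product. *)
rewrite (big_cat_nat (n := i)) ?(leq_trans ij) ?leqW //=.
rewrite [X in _ = X + _]big_nat_cond [X in _ = X + _]big1; last first.
  by move=> k /andP[/andP[_ ki] _]; rewrite /F leqNgt ki mul0r.
rewrite add0r (big_cat_nat (n := j.+1)) ?ltnS ?leqW //=.
rewrite [X in _ = _ + X]big_nat_cond [X in _ = _ + X]big1; last first.
  by move=> k /andP[/andP[jk _] _]; rewrite /F [(k <= j)%N]leqNgt jk mulr0.
rewrite addr0 (size_segment ij jw).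
rewrite -[X in _ = \big[_/_]_(X <= _ < _) _]add0n big_addn subSn // big_mkord.
apply: eq_bigr => k _; rewrite /F leq_addl.
have kij : (k <= j - i)%N by rewrite -ltnS.
have -> : (k + i <= j)%N by rewrite addnC -leq_subRL.
rewrite /segment addnK take_takel //; congr (_ * nccoef _ _).
by rewrite -[X in drop _ (take X _)](subnK kij) -take_drop drop_drop subnDA subnAC.
Qed.

Lemma ncev_word_mx (f : ncf R V) : ncev (fun v => word_mx (NVar v)) f = word_mx f.
Proof.
elim: f => [//|c|g IHg h IHh|g IHg h IHh] /=; last by rewrite IHg IHh word_mx_mul.
(* A constant gives a scalar matrix because the factor between cuts [i <= j] is empty only if
   [i = j]. *)
- apply/matrixP=> i j; rewrite !mxE -[RHS]/(if (i <= j)%N then _ else _).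
  case: leqP => ij /=.
    have jw : (j <= size w)%N by rewrite -ltnS.
    rewrite -size_eq0 size_segment // subn_eq0.
    have -> : (j <= i)%N = (i == j) by rewrite -val_eqE /= eqn_leq ij.
    by case: eqP => _; rewrite ?mulr1 ?mulr0.
  by case: eqP ij => [->|]; rewrite ?ltnn ?mulr0.
- by rewrite IHg IHh; apply/matrixP=> i j; rewrite !mxE /=; case: leqP => _; rewrite ?addr0.
Qed.

Lemma word_mx_corner (f : ncf R V) : word_mx f ord0 ord_max = nccoef f w.
Proof. by rewrite mxE /= /segment drop0 subn0 take_size. Qed.

End WordMatrix.

(* The coefficient of a word w is an entry of the value at suitable strictly
   upper triangular matrices, so the identities holding in every algebra are
   those of the free algebra. *)
Lemma nceq_ncev (V : eqType) (f g : ncf R V) :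
  (forall (A : algType R) (s : V -> A), ncev s f = ncev s g) -> nceq f g.
Proof. by move=> H w; rewrite -!word_mx_corner -!ncev_word_mx H. Qed.

End Evaluation.

(** * List membership without decidable equality *)

Section ListMembership.
Variables (S T : Type).

Lemma In_map (f : S -> T) x l : List.In x l -> List.In (f x) (map f l).
Proof. by elim: l => //= y l IH [->|/IH]; [left|right]. Qed.

Lemma In_mapP (f : S -> T) y l :
  List.In y (map f l) -> exists2 x, List.In x l & y = f x.
Proof.
elim: l => //= x l IH [<-|/IH[z lz ->]]; first by exists x => //; left.
by exists z => //; right.
Qed.

Lemma In_nthP (x0 x : T) l :
  List.In x l -> exists2 j, (j < size l)%N & nth x0 l j = x.
Proof.
elim: l => //= y l IH [->|/IH[j lj <-]]; first by exists 0%N.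
by exists j.+1.
Qed.

Lemma nth_In (x0 : T) l j : (j < size l)%N -> List.In (nth x0 l j) l.
Proof. by elim: l j => //= y l IH [|j] lj; [left|right; apply: IH]. Qed.

Lemma In_take (x0 : T) l i j :
  (j < i)%N -> (j < size l)%N -> List.In (nth x0 l j) (take i l).
Proof. by move=> ji jl; rewrite -(nth_take _ ji); apply: nth_In; rewrite size_take; case: ifP. Qed.

Lemma take_In (x : T) l i : List.In x (take i l) -> List.In x l.
Proof. by elim: l i => [|y l IH] [|i] //= [->|/IH]; [left|right]. Qed.

End ListMembership.

Lemma mem_In (T : eqType) (x : T) l : x \in l -> List.In x l.
Proof.
by elim: l => //= y l IH; rewrite in_cons => /orP[/eqP->|/IH]; [left|right].
Qed.

(** * Calculus of certificates for ideal membership *)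

Section Certificates.
Variable R : comNzRingType.
Implicit Types f g z : ncf R nat.

Definition ncsub (V : Type) (f g : ncf R V) := NAdd f (NMul (NConst (-1)) g).
Definition nccomm (V : Type) (f g : ncf R V) := ncsub (NMul f g) (NMul g f).
Definition ncprod (V : Type) (l : seq (ncf R V)) := foldr NMul (NConst 1) l.

Lemma ncev_one_minus (V : Type) (A : algType R) (s : V -> A) (f : ncf R V) :
  ncev s (ncone_minus f) = 1 - ncev s f.
Proof. by rewrite /= scaleN1r mulN1r scale1r. Qed.

Lemma ncev_prod_rcons (V : Type) (A : algType R) (s : V -> A) (l : seq (ncf R V)) (f : ncf R V) :
  ncev s (ncprod (rcons l f)) = ncev s (ncprod l) * ncev s f.
Proof. by elim: l => /= [|g l ->]; rewrite ?scale1r ?mulr1 ?mul1r ?mulrA. Qed.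

Lemma ncsize_gt0 (V : Type) (f : ncf R V) : (0 < ncsize f)%N.
Proof. by case: f. Qed.

Lemma ncvars_prod (V : Type) (P : V -> bool) (l : seq (ncf R V)) :
  (forall u, List.In u l -> ncvars P u) -> ncvars P (ncprod l).
Proof.
elim: l => //= u l IH H; rewrite H ?IH //; last by left.
by move=> v lv; apply: H; right.
Qed.

Definition lift_var (V W : Type) (f : ncf R V) : ncf R (V + W) :=
  ncsubst (fun v => NVar (inl v)) f.

Lemma ncsize_lift (V W : Type) (f : ncf R V) : ncsize (lift_var W f) = ncsize f.
Proof. by elim: f => //= g -> h ->. Qed.

Lemma ncvars_lift (V W : Type) (P : V + W -> bool) (f : ncf R V) :
  ncvars P (lift_var W f) = ncvars (fun v => P (inl v)) f.
Proof. by elim: f => //= g -> h ->. Qed.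

Lemma ncev_lift (V W : Type) (A : algType R) (s : V + W -> A) (f : ncf R V) :
  ncev s (lift_var W f) = ncev (fun v => s (inl v)) f.
Proof. by rewrite ncev_subst. Qed.

Variables (n : nat) (axs : seq (ncf R nat)).

Definition var_ok (v : nat + nat) : bool :=
  match v with inl i => (i < n)%N | inr j => (j < size axs)%N end.
Definition at_zero (A : algType R) (s : nat -> A) (v : nat + nat) : A :=
  match v with inl i => s i | inr _ => 0 end.
Definition at_axioms (A : algType R) (s : nat -> A) (v : nat + nat) : A :=
  match v with inl i => s i | inr j => ncev s (nth (NConst 0) axs j) end.

(* A formula of size at most k witnessing that f lies in the two-sided ideal
   generated by the axioms. *)
Definition certified f (k : nat) : Prop :=
  exists Phi : ncf R (nat + nat),
  [/\ (ncsize Phi <= k)%N, ncvars var_ok Phi,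
      forall (A : algType R) (s : nat -> A), ncev (at_zero s) Phi = 0 &
      forall (A : algType R) (s : nat -> A), ncev (at_axioms s) Phi = ncev s f].

Let below f := ncvars (fun i => (i < n)%N) f.

Lemma certified_le f k k' : certified f k -> (k <= k')%N -> certified f k'.
Proof. by move=> [Phi [sz ? ? ?]] kk; exists Phi; split=> //; apply: leq_trans kk. Qed.

Lemma certified_eq f g k :
  (forall (A : algType R) (s : nat -> A), ncev s f = ncev s g) ->
  certified f k -> certified g k.
Proof. by move=> fg [Phi [? ? ? E]]; exists Phi; split=> // A s; rewrite E. Qed.

Lemma certified0 f :
  (forall (A : algType R) (s : nat -> A), ncev s f = 0) -> certified f 1.
Proof. by move=> f0; exists (NConst 0); split=> // A s /=; rewrite scale0r ?f0. Qed.

Lemma certified_nth j :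
  (j < size axs)%N -> certified (nth (NConst 0) axs j) 1.
Proof. by move=> lj; exists (NVar (inr j)). Qed.

Lemma certifiedD f g k l :
  certified f k -> certified g l -> certified (NAdd f g) (k + l).+1.
Proof.
move=> [F [sF vF F0 FE]] [G [sG vG G0 GE]]; exists (NAdd F G); split=> [||A s|A s] /=.
- by rewrite ltnS leq_add.
- by rewrite vF.
- by rewrite F0 G0 addr0.
- by rewrite FE GE.
Qed.

Lemma certifiedMl g f k :
  below g -> certified f k -> certified (NMul g f) (ncsize g + k).+1.
Proof.
move=> bg [F [sF vF F0 FE]]; exists (NMul (lift_var _ g) F); split=> [||A s|A s] /=.
- by rewrite ncsize_lift ltnS leq_add2l.
- by rewrite ncvars_lift (bg : ncvars (fun i => var_ok (inl i)) g) vF.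
- by rewrite F0 mulr0.
- by rewrite FE ncev_lift.
Qed.

Lemma certifiedMr g f k :
  below g -> certified f k -> certified (NMul f g) (k + ncsize g).+1.
Proof.
move=> bg [F [sF vF F0 FE]]; exists (NMul F (lift_var _ g)); split=> [||A s|A s] /=.
- by rewrite ncsize_lift ltnS leq_add2r.
- by rewrite vF ncvars_lift (bg : ncvars (fun i => var_ok (inl i)) g).
- by rewrite F0 mul0r.
- by rewrite FE ncev_lift.
Qed.

Lemma certifiedZ c f k : certified f k -> certified (NMul (NConst c) f) k.+2.
Proof. by move=> cf; apply: certifiedMl. Qed.

(** * Commutators and idempotence of translated formulas *)

Hypothesis comm_ax : forall i j, (i < j < n)%N ->
  certified (nccomm (NVar i) (NVar j)) 1.
Hypothesis bool_ax : forall i, (i < n)%N ->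
  certified (NMul (NVar i) (ncone_minus (NVar i))) 1.

(** Induction on [f] by the Leibniz rule [[fg, x] = f [g, x] + [f, x] g]. Each product adds the
    sizes of both factors once, so the total is quadratic. *)
Lemma certified_comm_var f j : below f -> (j < n)%N ->
  certified (nccomm f (NVar j)) (3 * ncsize f ^ 2).
Proof.
move=> + jn; elim: f => [i|c|f IHf g IHg|f IHf g IHg] /=.
- move=> lin; case: (ltngtP i j) => [ij|ji|->].
  + by apply: certified_le (comm_ax _) _; rewrite ?ij.
  + apply: (@certified_le _ 3) => //.
    apply: certified_eq (certifiedZ (-1) (comm_ax (i := j) (j := i) _)) => [A s|].
      by rewrite /= !scaleN1r !mulN1r opprB addrC.
    by rewrite ji.
  + apply: certified_le (certified0 _) _ => // A s.
    by rewrite /= scaleN1r mulN1r subrr.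
- move=> _; apply: certified_le (certified0 _) _ => // A s.
  by rewrite /= scaleN1r mulN1r mulr_algl mulr_algr subrr.
- move=> /andP[/IHf cf /IHg cg].
  apply: certified_le (certified_eq _ (certifiedD cf cg)) _ => [A s|].
    by rewrite /= !scaleN1r !mulN1r mulrDl mulrDr opprD addrACA.
  nia.
- move=> /andP[bf bg].
  apply: certified_le (certified_eq _ (certifiedD (certifiedMl bf (IHg bg))
    (certifiedMr bg (IHf bf)))) _ => [A s|].
    by rewrite /= !scaleN1r !mulN1r mulrBr mulrBl !mulrA subrKA.
  nia.
Qed.

(** The Leibniz rule again, now in the second argument, with the single-variable case at the
    leaves. *)
Lemma certified_comm f g : below f -> below g ->
  certified (nccomm f g) (3 * ncsize f ^ 2 * ncsize g ^ 2).
Proof.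
move=> bf; have sf : (0 < ncsize f ^ 2)%N by rewrite expn_gt0 ncsize_gt0.
elim: g => [j|c|g IHg h IHh|g IHg h IHh] /=.
- by move=> jn; rewrite exp1n muln1; apply: certified_comm_var.
- move=> _; apply: certified_le (certified0 _) _ => [A s|].
    by rewrite /= scaleN1r mulN1r mulr_algl mulr_algr subrr.
  lia.
- move=> /andP[/IHg cg /IHh ch].
  apply: certified_le (certified_eq _ (certifiedD cg ch)) _ => [A s|].
    by rewrite /= !scaleN1r !mulN1r mulrDl mulrDr opprD addrACA.
  have := ncsize_gt0 g; nia.
- move=> /andP[bg bh].
  apply: certified_le (certified_eq _ (certifiedD (certifiedMr bh (IHg bg))
    (certifiedMl bg (IHh bh)))) _ => [A s|].
    by rewrite /= !scaleN1r !mulN1r mulrBr mulrBl !mulrA subrKA.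
  have := ncsize_gt0 g; have := ncsize_gt0 h; nia.
Qed.

(** At the factor [u], with [p] the product to its right, [u p z = (u z) p + u [p, z]]. Factors to
    the left of [u] only multiply the result, so a commutator is paid for once. *)
Lemma certified_prod_mul (l : seq (ncf R nat)) u z k :
  (forall v, List.In v l -> below v) -> below z -> List.In u l ->
  certified (NMul u z) k ->
  certified (NMul (ncprod l) z)
    (k + 3 * ncsize (ncprod l) ^ 2 * ncsize z ^ 2 + ncsize (ncprod l) + 2).
Proof.
move=> + bz + cu; elim: l => //= v l IH bl.
have bv : below v by apply: bl; left.
have bl' w : List.In w l -> below w by move=> lw; apply: bl; right.
have bp : below (ncprod l) by apply: ncvars_prod.
case=> [vu|/(IH bl') cl].
  have cv : certified (NMul v z) k by rewrite vu.
  apply: certified_le (certified_eq _ (certifiedD (certifiedMr bp cv)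
    (certifiedMl bv (certified_comm bp bz)))) _ => [A s|].
    by rewrite /= !scaleN1r !mulN1r mulrBr !mulrA addrC subrK.
  nia.
apply: certified_le (certified_eq _ (certifiedMl bv cl)) _ => [A s|].
  by rewrite /= mulrA.
nia.
Qed.

Definition ncbool (V : Type) (f : ncf R V) := NMul f (ncone_minus f).

Lemma certified_bool_not f k :
  certified (ncbool f) k -> certified (ncbool (ncone_minus f)) k.
Proof.
apply: certified_eq => A s.
by rewrite /= !scaleN1r !mulN1r scale1r subKr mulrBl mulrBr mul1r mulr1.
Qed.

(** From the identity [fg(1 - fg) = f(1 - f)g + ff g(1 - g) + f [f, g] g]. *)
Lemma certified_bool_mul f g k l : below f -> below g ->
  certified (ncbool f) k -> certified (ncbool g) l ->
  certified (ncbool (NMul f g))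
    (k + l + 3 * ncsize f ^ 2 * ncsize g ^ 2 + 3 * ncsize f + 2 * ncsize g + 8).
Proof.
move=> bf bg cf cg.
have bff : below (NMul f f) by apply/andP.
apply: certified_le (certified_eq _ (certifiedD (certifiedD (certifiedMr bg cf)
  (certifiedMl bff cg)) (certifiedMl bf (certifiedMr bg (certified_comm bf bg))))) _.
  move=> A s; rewrite /= !scaleN1r !mulN1r !scale1r.
  by rewrite !(mulrBr, mulrBl, mulr1) !mulrA !subrKA.
rewrite /=; lia.
Qed.

Lemma below_tr F : fvars_below n F -> below (tr F).
Proof. by rewrite /below; elim: F => //= F IHF G IHG /andP[/IHF -> /IHG]. Qed.

(** A single [N] bounds the translations of all subformulas, so every connective has the same cost
    and the induction is linear in [fsize F]. *)
Lemma certified_bool_tr F N : fvars_below n F -> (ncsize (tr F : ncf R nat) <= N)%N ->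
  certified (ncbool (tr F)) (fsize F * (3 * N ^ 4 + 5 * N + 8)).
Proof.
have mulb f g : (ncsize f <= N)%N -> (ncsize g <= N)%N ->
    (3 * ncsize f ^ 2 * ncsize g ^ 2 <= 3 * N ^ 4)%N.
  by move=> fN gN; rewrite -mulnA leq_mul2l -[4%N]/(2 + 2)%N expnD leq_mul ?leq_exp2r ?orbT.
elim: F => [i|||F IHF|F IHF G IHG|F IHF G IHG] /= bF sF.
- by apply: certified_le (bool_ax bF) _; lia.
- apply: certified_le (certified0 _) _ => [A s|]; last by lia.
  by rewrite /= scale0r mul0r.
- apply: certified_le (certified0 _) _ => [A s|]; last by lia.
  by rewrite /= scale1r scaleN1r mulN1r subrr mulr0.
- by apply: certified_le (certified_bool_not (IHF _ _)) _; lia.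
- move/andP: bF => [bF bG].
  apply: certified_le (certified_bool_mul (below_tr bF) (below_tr bG)
    (IHF bF _) (IHG bG _)) _; try lia.
  have := mulb (tr F) (tr G); set M := (3 * N ^ 4)%N; nia.
- move/andP: bF => [bF bG].
  apply: certified_le (certified_bool_not (certified_bool_mul
    (below_tr (F := PNot F) bF) (below_tr (F := PNot G) bG)
    (certified_bool_not (IHF bF _)) (certified_bool_not (IHG bG _)))) _; try lia.
  have := mulb (tr (PNot F)) (tr (PNot G)); rewrite /=; set M := (3 * N ^ 4)%N; nia.
Qed.

Lemma expn_le5 N k : (0 < N)%N -> (k <= 5)%N -> (N ^ k <= N ^ 5)%N.
Proof. exact: leq_pexp2l. Qed.

Lemma fsize_le_tr F : (fsize F <= ncsize (tr F : ncf R nat))%N.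
Proof. by elim: F => //=; lia. Qed.

Lemma certified_bool F N : fvars_below n F -> (ncsize (tr F : ncf R nat) <= N)%N ->
  certified (ncbool (tr F)) (16 * N ^ 5).
Proof.
move=> bF sF; apply: certified_le (certified_bool_tr bF sF) _.
have N0 : (0 < N)%N := leq_trans (ncsize_gt0 _) sF.
have e4 : (3 * N ^ 4 + 5 * N + 8 <= 16 * N ^ 4)%N.
  have := leq_pexp2l N0 (isT : 1 <= 4)%N; have := leq_pexp2l N0 (isT : 0 <= 4)%N.
  rewrite expn0 expn1; lia.
rewrite -[5%N]/(1 + 4)%N expnD expn1 mulnCA; apply: leq_mul => //.
exact: leq_trans (fsize_le_tr F) sF.
Qed.

(** Here [chi] acts as the indicator of a partial assignment: a certificate of [chi (f - v)] says
    that, modulo the axioms, [f] has value [v] under it. *)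
Lemma certified_value_not chi f v k :
  certified (NMul chi (ncsub f (NConst v))) k ->
  certified (NMul chi (ncsub (ncone_minus f) (NConst (1 - v)))) k.+2.
Proof.
move=> /(certifiedZ (-1)); apply: certified_eq => A s.
rewrite /= !scaleN1r !mulN1r scale1r scalerBl scale1r -mulrN; congr (_ * _).
by rewrite !opprB [RHS]addrC addrA subrK.
Qed.

(** From [chi (fg - vw) = chi (f - v) g + v chi (g - w)]. *)
Lemma certified_value_mul chi f g v w k l : below g ->
  certified (NMul chi (ncsub f (NConst v))) k ->
  certified (NMul chi (ncsub g (NConst w))) l ->
  certified (NMul chi (ncsub (NMul f g) (NConst (v * w)))) (k + l + ncsize g + 4).
Proof.
move=> bg cf cg.
apply: certified_le (certified_eq _ (certifiedD (certifiedMr bg cf) (certifiedZ v cg))) _.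
  move=> A s; rewrite /= !scaleN1r !mulN1r !mulrBr !mulr_algr !mulr_algl.
  by rewrite mulrBl -scalerAl scalerA subrKA mulrA.
lia.
Qed.

Definition truth (b : bool) : R := if b then 0 else 1.

Fixpoint fvars (F : Defs.form) : seq nat :=
  match F with
  | PVar i => [:: i] | PTrue | PFalse => [::]
  | PNot G => fvars G
  | POr G H | PAnd G H => fvars G ++ fvars H
  end.

Lemma fvars_below_subst s F :
  (forall p, fvars_below n (s p)) -> fvars_below n (fsubst s F).
Proof. by move=> bs; elim: F => //= F -> G ->. Qed.

(** The factor 13 is the cost of a conjunction: three uses of [ncone_minus] at four nodes each and
    one product gate. *)
Lemma ncsize_tr_subst s F N : (0 < N)%N ->
  (forall p, p \in fvars F -> (ncsize (tr (s p) : ncf R nat) <= N)%N) ->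
  (ncsize (tr (fsubst s F) : ncf R nat) <= 13 * fsize F * N)%N.
Proof.
move=> N0; elim: F => [i|||F IHF|F IHF G IHG|F IHF G IHG] /= sN; try lia.
- by have := sN i (mem_head _ _); lia.
- by have := IHF sN; lia.
- have sF : (ncsize (tr (fsubst s F) : ncf R nat) <= 13 * fsize F * N)%N.
    by apply: IHF => p pF; apply: sN; rewrite mem_cat pF.
  have sG : (ncsize (tr (fsubst s G) : ncf R nat) <= 13 * fsize G * N)%N.
    by apply: IHG => p pG; apply: sN; rewrite mem_cat pG orbT.
  nia.
- have sF : (ncsize (tr (fsubst s F) : ncf R nat) <= 13 * fsize F * N)%N.
    by apply: IHF => p pF; apply: sN; rewrite mem_cat pF.
  have sG : (ncsize (tr (fsubst s G) : ncf R nat) <= 13 * fsize G * N)%N.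
    by apply: IHG => p pG; apply: sN; rewrite mem_cat pG orbT.
  nia.
Qed.

(** * Substitution instances of a fixed tautology *)

Section Tautology.
Variable s : nat -> Defs.form.
Hypothesis bs : forall p, fvars_below n (s p).

Lemma certified_value chi (a : nat -> bool) m M F :
  (ncsize (tr (fsubst s F) : ncf R nat) <= M)%N ->
  (forall p, p \in fvars F ->
     certified (NMul chi (ncsub (tr (s p)) (NConst (truth (a p))))) m) ->
  certified (NMul chi (ncsub (tr (fsubst s F)) (NConst (truth (feval a F)))))
    (fsize F * (m + M + 14)).
Proof.
have b G : below (tr (fsubst s G)) by apply/below_tr/fvars_below_subst.
elim: F => [i|||F IHF|F IHF G IHG|F IHF G IHG] /= sM cv.
- by apply: certified_le (cv i (mem_head _ _)) _; lia.
- apply: certified_le (certified0 _) _ => [A t|]; last by lia.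
  by rewrite /= scale0r scaleN1r mulN1r subrr mulr0.
- apply: certified_le (certified0 _) _ => [A t|]; last by lia.
  by rewrite /= scaleN1r mulN1r subrr mulr0.
- have -> : truth (~~ feval a F) = 1 - truth (feval a F).
    by case: (feval a F); rewrite /truth /= ?subr0 ?subrr.
  by apply: certified_le (certified_value_not (IHF _ cv)) _; lia.
- have -> : truth (feval a F || feval a G) = truth (feval a F) * truth (feval a G).
    by case: (feval a F); case: (feval a G); rewrite /truth /= ?mulr0 ?mulr1 ?mul0r.
  apply: certified_le (certified_value_mul (b G) (IHF _ _) (IHG _ _)) _; try lia.
  + by move=> p pF; apply: cv; rewrite mem_cat pF.
  + by move=> p pF; apply: cv; rewrite mem_cat pF orbT.
- have -> : truth (feval a F && feval a G) =
      1 - (1 - truth (feval a F)) * (1 - truth (feval a G)).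
    by case: (feval a F); case: (feval a G);
      rewrite /truth /= ?subr0 ?subrr ?mulr0 ?mulr1 ?mul0r ?subr0 ?subrr.
  apply: certified_le (certified_value_not (certified_value_mul (b (PNot G))
    (certified_value_not (IHF _ _)) (certified_value_not (IHG _ _)))) _; try lia.
  + by move=> p pF; apply: cv; rewrite mem_cat pF.
  + by move=> p pF; apply: cv; rewrite mem_cat pF orbT.
  + by rewrite mulSn mulnDl /=; lia.
Qed.

(** The indicator of [s p] having truth value [v]. Its product with [tr (s p) - truth v] is, up to
    sign, the Boolean polynomial of [tr (s p)]. *)
Definition literal (pv : nat * bool) : ncf R nat :=
  if pv.2 then ncone_minus (tr (s pv.1)) else tr (s pv.1).

Lemma certified_literal p v k : certified (ncbool (tr (s p))) k ->
  certified (NMul (literal (p, v)) (ncsub (tr (s p)) (NConst (truth v)))) k.+2.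
Proof.
case: v => cb; rewrite /literal /=.
  apply: certified_le (certified_eq _ cb) _ => [A t|]; last by lia.
  by rewrite /= scale0r !scaleN1r !mulN1r oppr0 addr0 scale1r mulrBl mulrBr mul1r mulr1.
apply: certified_eq (certifiedZ (-1) cb) => A t.
by rewrite /= !scale1r !scaleN1r !mulN1r -mulrN opprB.
Qed.

Lemma below_literal pv : below (literal pv).
Proof. by rewrite /literal; case: ifP => _; rewrite /below /= -/(below _) below_tr. Qed.

(* A prefix of V literals has size at most (6 V + 1) N, and b - v has size at
   most 5 N; commuting them costs 3 ((6 V + 1) N)^2 (5 N)^2. *)
Definition prefix_cost (V : nat) : nat := 75 * (6 * V + 1) ^ 2 + 6 * V + 40.
Definition tautology_cost F : nat :=
  let V := size (fvars F) in
  3 ^ V * ((fsize F).+1 * (prefix_cost V + 13 * fsize F)).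

Lemma prefix_cost_gt0 V : (0 < prefix_cost V)%N.
Proof. by rewrite /prefix_cost addn_gt0 orbT. Qed.

Lemma ncsize_assigned N d :
  (0 < N)%N -> (forall pv, pv \in d -> (ncsize (tr (s pv.1) : ncf R nat) <= N)%N) ->
  (ncsize (ncprod (map literal d)) <= (6 * size d + 1) * N)%N.
Proof.
move=> N0; elim: d => //= [_|[p v] d IH dN]; first by rewrite mul1n.
have {}IH : (ncsize (ncprod (map literal d)) <= (6 * size d + 1) * N)%N.
  by apply: IH => pv pd; apply: dN; rewrite in_cons pd orbT.
have : (ncsize (literal (p, v)) <= N + 4)%N.
  have sp : (ncsize (tr (s p) : ncf R nat) <= N)%N := dN (p, v) (mem_head _ _).
  by rewrite /literal; case: v {dN} => /=; lia.
by move: IH => /=; move: (size d) (ncsize _) (ncsize _) => m x y; nia.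
Qed.

(** The literals in [d] fix every [s p], so [F] can be evaluated under their product; as a tautology
    it has value true, that is 0. *)
Lemma certified_assigned F N d :
  tautology F -> (0 < N)%N ->
  (forall p, p \in fvars F -> (ncsize (tr (s p) : ncf R nat) <= N)%N) ->
  (forall p, p \in fvars F -> (p, true) \in d \/ (p, false) \in d) ->
  (forall pv, pv \in d -> pv.1 \in fvars F) ->
  certified (NMul (ncprod (map literal d)) (tr (fsubst s F)))
    ((fsize F).+1 * (prefix_cost (size d) + 13 * fsize F) * N ^ 5).
Proof.
move=> tF N0 sN assigned dF.
have sX := ncsize_assigned N0 (fun pv pd => sN _ (dF pv pd)).
set X := ncprod _ in sX *; pose a p := (p, true) \in d.
(* [fvars F] repeats variables, so [d] may hold both literals of [p]. Either one forces its own
   value, so the choice made by [a] is harmless. *)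
have ad p : p \in fvars F -> (p, a p) \in d.
  by rewrite /a => pF; case: (boolP ((p, true) \in d)) (assigned p pF) => // _ [].
have N1 : (1 <= N ^ 5)%N by rewrite expn_gt0 N0.
have NN : (N <= N ^ 5)%N by apply: (expn_le5 (k := 1)).
(* The 14 subtracted here pays for the constant in the bound of [certified_value]. *)
have aX p : p \in fvars F ->
    certified (NMul X (ncsub (tr (s p)) (NConst (truth (a p)))))
      ((prefix_cost (size d) - 14) * N ^ 5).
  move=> pF.
  have cb := certified_literal (a p) (certified_bool (bs p) (sN p pF)).
  have bz : below (ncsub (tr (s p)) (NConst (truth (a p)))).
    by apply/andP; split; [apply: below_tr|].
  have bl u : List.In u (map literal d) -> below u.
    by move=> inu; have [pv _ ->] := In_mapP inu; apply: below_literal.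
  apply: certified_le (certified_prod_mul bl bz (In_map _ (mem_In (ad p pF))) cb) _.
  have sz : (ncsize (ncsub (tr (s p)) (NConst (truth (a p)))) <= 5 * N)%N.
    by have := sN p pF; rewrite /=; lia.
  have sXz : (3 * ncsize X ^ 2 * ncsize (ncsub (tr (s p)) (NConst (truth (a p)))) ^ 2
      <= 75 * (6 * size d + 1) ^ 2 * N ^ 5)%N.
    apply: (@leq_trans (3 * ((6 * size d + 1) * N) ^ 2 * (5 * N) ^ 2)).
      by apply: leq_mul; rewrite ?leq_mul2l ?leq_sqr.
    have -> : (3 * ((6 * size d + 1) * N) ^ 2 * (5 * N) ^ 2 =
        75 * (6 * size d + 1) ^ 2 * N ^ 4)%N by rewrite !expnMn; lia.
    by rewrite leq_mul2l expn_le5 ?orbT.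
  have sX5 : (ncsize X <= (6 * size d + 1) * N ^ 5)%N.
    by apply: leq_trans sX _; rewrite leq_mul2l NN orbT.
  rewrite -/X /prefix_cost; move: sXz; set c := (75 * _)%N => sXz.
  rewrite (_ : (c + 6 * size d + 40 - 14 = c + (6 * size d + 1) + 25)%N); last lia.
  rewrite !mulnDl; lia.
have sF := ncsize_tr_subst N0 sN.
apply: certified_le (certified_eq _ (certified_value sF aX)) _.
  by move=> A t; rewrite tF /= scale0r mulr0 addr0.
rewrite -[leqRHS]mulnA; apply: leq_mul => //.
set q := (prefix_cost _ - 14)%N.
have -> : (prefix_cost (size d) = q + 14)%N by rewrite subnK // /prefix_cost; lia.
by move: (N ^ 5)%N N1 NN (fsize F) q => M N1 NN f q; nia.
Qed.

(* Shannon expansion over the variables of F that have no assigned value. *)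
Lemma certified_expansion F N vs d :
  tautology F -> (0 < N)%N ->
  (forall p, p \in fvars F -> (ncsize (tr (s p) : ncf R nat) <= N)%N) ->
  (forall p, p \in fvars F -> [\/ p \in vs, (p, true) \in d | (p, false) \in d]) ->
  {subset vs <= fvars F} -> (forall pv, pv \in d -> pv.1 \in fvars F) ->
  certified (NMul (ncprod (map literal d)) (tr (fsubst s F)))
    (3 ^ size vs * ((fsize F).+1 * (prefix_cost (size vs + size d) + 13 * fsize F) * N ^ 5)).
Proof.
move=> tF N0 sN; elim: vs d => [|p vs IH] d asg vsF dF.
  rewrite mul1n; apply: certified_assigned => // p /asg[] //; by [left|right].
have step v : certified (NMul (NMul (literal (p, v)) (ncprod (map literal d)))
    (tr (fsubst s F))) (3 ^ size vs * ((fsize F).+1 *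
      (prefix_cost ((size vs).+1 + size d) + 13 * fsize F) * N ^ 5)).
  (* Moving a variable from [vs] to [d] preserves the total length, so [prefix_cost] is the same at
     all levels of the expansion. *)
  rewrite addSnnS; apply: (IH ((p, v) :: d)).
  - move=> q /asg; rewrite !in_cons !xpair_eqE.
    case=> [/orP[/eqP->|->]|->|->]; rewrite ?orbT; [|by constructor..].
    by rewrite eqxx; case: v; [constructor 2|constructor 3].
  - by move=> q qvs; apply: vsF; rewrite in_cons qvs orbT.
  - by move=> pv; rewrite in_cons => /orP[/eqP->|/dF//]; apply: vsF (mem_head _ _).
(* The two literals of [p] sum to 1. *)
apply: certified_le (certified_eq _ (certifiedD (step true) (step false))) _.
  move=> A t; rewrite /= scaleN1r mulN1r scale1r.
  by rewrite -!mulrDl subrK mul1r.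
(* Two branches of cost [c] and one addition gate cost [2c + 1 <= 3c], whence the power of 3. *)
rewrite /= (expnS 3) -mulnA; set c := (3 ^ _ * _)%N.
have : (0 < c)%N.
  by rewrite !muln_gt0 !expn_gt0 N0 addn_gt0 prefix_cost_gt0.
lia.
Qed.

Lemma certified_tautology F N :
  tautology F -> (0 < N)%N ->
  (forall p, p \in fvars F -> (ncsize (tr (s p) : ncf R nat) <= N)%N) ->
  certified (tr (fsubst s F)) (tautology_cost F * N ^ 5).
Proof.
move=> tF N0 sN.
have asg p : p \in fvars F -> [\/ p \in fvars F, (p, true) \in [::] | (p, false) \in [::]].
  by constructor 1.
have := certified_expansion tF N0 sN asg (fun _ => id).
move=> /(_ (fun pv (h : pv \in [::]) => False_ind _ (notF h))).
rewrite addn0 !mulnA -(mulnA (3 ^ _)%N); apply: certified_eq => A t.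
by rewrite /= scale1r mul1r.
Qed.
End Tautology.

(** * Simulating one inference *)

Definition implication (l : seq Defs.form) (B : Defs.form) : Defs.form :=
  foldr (fun A C => POr (PNot A) C) B l.

Lemma tautology_implication (r : rule) :
  rule_sound r -> tautology (implication r.1 r.2).
Proof.
case: r => l B sd a; move: (sd a) => {sd} /=; elim: l => [|A l IH] sd /=.
  by apply: sd.
case aA: (feval a A) => //=; apply: IH => h; apply: sd => C [<-|/h]//.
Qed.

Lemma fvars_implication l B p :
  p \in fvars (implication l B) ->
  p \in fvars B \/ exists2 A, List.In A l & p \in fvars A.
Proof.
elim: l => [|A l IH] /=; first by left.
rewrite mem_cat => /orP[pA|/IH[|[C lC pC]]]; [|by left|].
  by right; exists A => //; left.
by right; exists C => //; right.
Qed.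

(** Independent of the substitution, hence a constant of the Frege system once summed over its
    finitely many rules. *)
Definition rule_cost (r : rule) : nat :=
  let F := implication r.1 r.2 in
  tautology_cost F + 2 + size r.1 * (13 * fsize F + 26).

(** The translated implication is [(1 - a) c], with [a] its first premise and [c] the remaining
    implication. From [E (1 - a) c + (E a) c = E c] the premises are discharged one by one. *)
Lemma certified_rule r s N E : rule_sound r ->
  (forall p, fvars_below n (s p)) -> (0 < N)%N ->
  (forall p, p \in fvars (implication r.1 r.2) ->
     (ncsize (tr (s p) : ncf R nat) <= N)%N) ->
  below E -> (ncsize E <= N)%N ->
  (forall A, List.In A r.1 ->
     certified (NMul E (tr (fsubst s A))) (24 * N ^ 5)) ->
  certified (NMul E (tr (fsubst s r.2))) (rule_cost r * N ^ 5).
Proof.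
move=> sr bs N0 sN bE sE prem; rewrite /rule_cost.
set F := implication _ _ in sN *.
have sF := ncsize_tr_subst N0 sN; set G := (13 * fsize F * N)%N in sF.
have N1 : (1 <= N ^ 5)%N by rewrite expn_gt0 N0.
have NN : (N <= N ^ 5)%N by apply: (expn_le5 (k := 1)).
have := certifiedMl bE (certified_tautology bs (tautology_implication sr) N0 sN).
rewrite -/F; set x := (_.+1)%N => cx.
(* Discharging a premise costs its certificate, a copy of the remaining implication (at most [G]
   nodes) and two gates. *)
suff: certified (NMul E (tr (fsubst s r.2))) (x + size r.1 * (24 * N ^ 5 + G + 2)).
  move=> cE; apply: certified_le cE _; rewrite /x /G.
  by move: (N ^ 5)%N N1 NN (fsize F) (tautology_cost F) (size _) => M M1 NM f t z; nia.
clearbody x G; move: x cx sF; rewrite /F.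
elim: r.1 prem => [|A l IH] prem x cx sF /=.
  by rewrite addn0.
have bg : below (tr (fsubst s (implication l r.2))).
  by apply/below_tr/fvars_below_subst.
have sg : (ncsize (tr (fsubst s (implication l r.2)) : ncf R nat) <= G)%N.
  by move: sF => /=; lia.
have cg := certifiedD cx (certifiedMr bg (prem A (or_introl erefl))).
apply: certified_le (IH (fun B lB => prem B (or_intror lB)) _ (certified_eq _ cg) sg) _.
  move=> B t; rewrite /= !scaleN1r !mulN1r scale1r.
  by rewrite mulrBl mul1r mulrBr mulrA subrK.
by move: sg; set y := ncsize _; rewrite mulSn; lia.
Qed.

(** The factor [1 - tr A] of [E], brought next to [tr A], forms the Boolean polynomial of [tr A]. *)
Lemma certified_conjunct (l : seq Defs.form) A N :
  (forall B, List.In B l -> fvars_below n B) -> List.In A l ->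
  let E := ncprod (map (fun B => ncone_minus (tr B)) l) in
  (ncsize E <= N)%N -> (ncsize (tr A : ncf R nat) <= N)%N ->
  certified (NMul E (tr A)) (24 * N ^ 5).
Proof.
move=> bl lA E sE sA; have N0 : (0 < N)%N := leq_trans (ncsize_gt0 _) sE.
have bA := bl A lA.
have cA : certified (NMul (ncone_minus (tr A)) (tr A)) (16 * N ^ 5).
  apply: certified_eq (certified_bool bA sA) => B t.
  by rewrite /= !scaleN1r !mulN1r scale1r mulrBl mulrBr mul1r mulr1.
have bE u : List.In u (map (fun B => ncone_minus (tr B)) l) -> below u.
  by move=> inu; have [B lB ->] := In_mapP inu; apply: below_tr (bl B lB).
have inA := In_map (fun B => ncone_minus (tr B) : ncf R nat) lA.
apply: certified_le (certified_prod_mul bE (below_tr bA) inA cA) _.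
rewrite -/E.
have e1 : (3 * ncsize E ^ 2 * ncsize (tr A : ncf R nat) ^ 2 <= 3 * N ^ 5)%N.
  apply: (@leq_trans (3 * N ^ 2 * N ^ 2)).
    by apply: leq_mul; rewrite ?leq_mul2l leq_sqr.
  by rewrite -mulnA -expnD leq_mul2l expn_le5.
have N1 : (1 <= N ^ 5)%N by rewrite expn_gt0 N0.
have NN : (N <= N ^ 5)%N by apply: (expn_le5 (k := 1)).
by move: e1; set y := (3 * _ * _)%N; lia.
Qed.

(** * Size bounds in terms of the proof size *)

Lemma ncsize_tr F : (ncsize (tr F : ncf R nat) <= 13 * fsize F)%N.
Proof. by elim: F => //=; lia. Qed.

Lemma fsize_gt0 F : (0 < fsize F)%N.
Proof. by case: F. Qed.

Lemma fsize_subst s A p : p \in fvars A -> (fsize (s p) <= fsize (fsubst s A))%N.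
Proof.
elim: A => //= [i|A IHA|A IHA B IHB|A IHA B IHB].
- by rewrite inE => /eqP->.
- by move=> /IHA; apply: leqW.
- by rewrite mem_cat => /orP[/IHA|/IHB]; lia.
- by rewrite mem_cat => /orP[/IHA|/IHB]; lia.
Qed.

Lemma fsize_proof_size A ls : List.In A ls -> (fsize A <= proof_size ls)%N.
Proof. by elim: ls => //= B ls IH [->|/IH]; rewrite /proof_size /=; lia. Qed.

Lemma proof_size_take i ls : (proof_size (take i ls) <= proof_size ls)%N.
Proof.
by elim: ls i => [|A ls IH] [|i] //; rewrite /proof_size /= leq_add2l IH.
Qed.

Lemma size_proof_size ls : (size ls <= proof_size ls)%N.
Proof.
elim: ls => //= A ls IH; rewrite /proof_size /= -add1n.
by rewrite leq_add ?fsize_gt0.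
Qed.

Definition all_true (ls : seq Defs.form) : ncf R nat :=
  ncprod (map (fun A => ncone_minus (tr A)) ls).

Lemma ncsize_all_true ls : (ncsize (all_true ls) <= 18 * proof_size ls + 1)%N.
Proof.
elim: ls => //= A ls IH; move: IH; rewrite /proof_size /= -/(all_true ls).
by have := fsize_gt0 A; have := ncsize_tr A; lia.
Qed.

(** * Assembling the refutation from the proof lines *)

Section Refutation.
Variables (rules : seq rule) (ls : seq Defs.form).
Hypothesis rules_sound : forall r, List.In r rules -> rule_sound r.
Hypothesis ls_below : forall A, List.In A ls -> fvars_below n A.
Hypothesis ls_step : forall k, (k < size ls)%N ->
  exists r s, [/\ List.In r rules, forall p, fvars_below n (s p),
    fsubst s r.2 = nth PTrue ls k &
    forall A, List.In A r.1 -> exists2 j, (j < k)%N & nth PTrue ls j = fsubst s A].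

(** Large enough for the prefix products, of size at most [18 * proof_size ls + 1], and for the
    translation of any line. *)
Let N := (20 * (proof_size ls).+1)%N.
Let C := sumn (map rule_cost rules).

Lemma ncsize_all_true_take i : (ncsize (all_true (take i ls)) <= N)%N.
Proof.
have := ncsize_all_true (take i ls); have := proof_size_take i ls.
by rewrite /N; lia.
Qed.

Lemma below_all_true l : (forall A, List.In A l -> fvars_below n A) -> below (all_true l).
Proof.
move=> bl; apply: ncvars_prod => u inu; have [A lA ->] := In_mapP inu.
exact: below_tr (bl A lA).
Qed.

Lemma certified_line k : (k < size ls)%N ->
  certified (NMul (all_true (take k ls)) (tr (nth PTrue ls k))) (C * N ^ 5).
Proof.
move=> kls; have [r [s [inr bs eqk prem]]] := ls_step kls; rewrite -eqk.
have N0 : (0 < N)%N by rewrite muln_gt0.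
have sN A p : List.In (fsubst s A) ls -> p \in fvars A ->
    (ncsize (tr (s p) : ncf R nat) <= N)%N.
  move=> /fsize_proof_size sA /(fsize_subst s) sp.
  by apply: leq_trans (ncsize_tr _) _; rewrite /N; lia.
have take_below A : List.In A (take k ls) -> fvars_below n A.
  by move=> lA; apply: ls_below (take_In lA).
have inprem A : List.In A r.1 -> List.In (fsubst s A) (take k ls).
  by case/prem => j jk <-; apply: In_take => //; apply: ltn_trans jk kls.
apply: certified_le (certified_rule (rules_sound inr) bs N0 _ _ _ _) _.
- move=> p /fvars_implication[|[A /inprem lA]]; last exact: sN (take_In lA).
  by apply: sN; rewrite eqk; apply: nth_In.
- exact: below_all_true.
- exact: ncsize_all_true_take.
- move=> A inA; have lA := inprem A inA.
  apply: (certified_conjunct take_below lA); first exact: ncsize_all_true_take.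
  have := fsize_proof_size (take_In lA).
  by have := ncsize_tr (fsubst s A); rewrite /N; lia.
- rewrite leq_mul2r /C; apply/orP; right.
  by elim: rules inr => //= r' l IH [->|/IH]; [apply: leq_addr|lia].
Qed.

(* 1 - E_(k+1) = (1 - E_k) + E_k a_(k+1) for E_k = (1 - a_1) ... (1 - a_k). *)
Lemma certified_all_true k : (k <= size ls)%N ->
  certified (ncone_minus (all_true (take k ls))) (k * (C * N ^ 5 + 1)).+1.
Proof.
elim: k => [_|k IH kls].
  apply: certified_le (certified0 _) _ => // A t.
  by rewrite take0 /= scale1r scaleN1r mulN1r subrr.
apply: certified_le (certified_eq _ (certifiedD (IH (ltnW kls)) (certified_line kls))) _.
  move=> A t; rewrite (take_nth PTrue kls) /all_true map_rcons.
  rewrite [RHS]ncev_one_minus ncev_prod_rcons /= !scaleN1r !mulN1r scale1r.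
  by rewrite mulrBr mulr1 opprB -addrA (addrC (- _)).
by rewrite mulSn; lia.
Qed.

Lemma certified_one : ls <> [::] -> (0 < size axs)%N ->
  nth (NConst 0) axs 0 = tr (PNot (last PTrue ls)) ->
  certified (NConst 1) ((C + 6) * N ^ 6).
Proof.
move=> ls0 axs0 ax0; have sls : (0 < size ls)%N by case: (ls) ls0.
set k := (size ls).-1; have kls : k.+1 = size ls by rewrite prednK.
have cT : certified (tr (PNot (last PTrue ls))) 1 by rewrite -ax0; apply: certified_nth.
have bE : below (all_true (take k ls)).
  by apply: below_all_true => A lA; apply: ls_below (take_In lA).
have cE := certified_all_true (leqnn (size ls)).
(* With [m] lines, [1 = (1 - E_m) + E_(m-1) (1 - a_m)], and the last factor is literally the axiom
   [tr (PNot T)]. *)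
apply: certified_le (certified_eq _ (certifiedD cE (certifiedMl bE cT))) _.
  move=> A t; rewrite -{1}kls (take_nth PTrue) ?kls // /all_true map_rcons.
  rewrite [LHS]/= ncev_prod_rcons -/k nth_last.
  by rewrite /= !scaleN1r !mulN1r !scale1r subrK.
have := ncsize_all_true_take k; have := size_proof_size ls.
have N0 : (0 < N)%N by rewrite muln_gt0.
have N1 : (1 <= N ^ 5)%N by rewrite expn_gt0 N0.
have sN : (size ls <= N)%N by apply: leq_trans (size_proof_size ls) _; rewrite /N; lia.
rewrite (expnS N 5); move: (N ^ 5)%N (ncsize _) N1 (size ls) sN => M x M1 z zN _ xN.
have : (z * (C * M + 1) <= N * (C * M + 1))%N by rewrite leq_mul2r zN orbT.
nia.
Qed.

End Refutation.
End Certificates.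

(** * Eliminating variables foreign to the theorem *)

Section Restriction.
Variable n : nat.

(** A proof may mention variables of index at least [n], for which there are no axioms. Replacing
    them by [PTrue], also of size 1, keeps the proof valid and its size unchanged. *)
Definition restrict (i : nat) : Defs.form := if (i < n)%N then PVar i else PTrue.

Lemma fsubst_comp (s t : nat -> Defs.form) A :
  fsubst t (fsubst s A) = fsubst (fun i => fsubst t (s i)) A.
Proof. by elim: A => //= [A ->|A -> B ->|A -> B ->]. Qed.

Lemma fvars_below_restrict A : fvars_below n (fsubst restrict A).
Proof.
by elim: A => //= [i|A -> B -> //|A -> B -> //]; rewrite /restrict; case: ifP.
Qed.

Lemma fsize_restrict A : fsize (fsubst restrict A) = fsize A.
Proof.
by elim: A => //= [i|A ->|A -> B ->|A -> B ->] //; rewrite /restrict; case: ifP.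
Qed.

Lemma fsubst_restrict A : fvars_below n A -> fsubst restrict A = A.
Proof.
elim: A => //= [i|A IH /IH->|A IHA B IHB|A IHA B IHB] //.
- by rewrite /restrict => ->.
- by move=> /andP[/IHA-> /IHB->].
- by move=> /andP[/IHA-> /IHB->].
Qed.

Lemma proof_size_restrict ls : proof_size (map (fsubst restrict) ls) = proof_size ls.
Proof. by elim: ls => //= A ls; rewrite /proof_size /= fsize_restrict => ->. Qed.

End Restriction.

(** * The simulation over any nonzero commutative ring *)

Lemma frege_polynomially_simulated (R : comNzRingType) (P : frege_system) :
  nc_ips_psimulates R P.
Proof.
set C := sumn (map rule_cost (frege_rules P)).
(* This is [(C + 6) * N ^ 6] for [N = 20 * (proof_size ls).+1]. *)
exists ((C + 6) * 20 ^ 6)%N, 6%N => n T ls bT _ [ls0 [deriv lsT]].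
pose axs : seq (ncf R nat) := ips_axioms n T.
have certified_In f : List.In f axs -> certified n axs f 1.
  by move=> /(In_nthP (NConst 0))[j lj <-]; apply: certified_nth.
have comm_ax i j : (i < j < n)%N -> certified n axs (nccomm (NVar i) (NVar j)) 1.
  move=> /andP[ij jn]; apply: certified_In; right; apply: List.in_or_app; right.
  apply: (In_map _ (x := (i, j))); apply: mem_In; rewrite mem_filter ij /=.
  by apply: allpairs_f; rewrite mem_iota //= (ltn_trans ij).
have bool_ax i : (i < n)%N -> certified n axs (NMul (NVar i) (ncone_minus (NVar i))) 1.
  move=> lin; apply: certified_In; right; apply: List.in_or_app; left.
  by apply: (In_map _ (x := i)); apply: mem_In; rewrite mem_iota.
pose ms := map (fsubst (restrict n)) ls.
have sms : size ms = size ls by rewrite size_map.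
(* This holds for all [k], because substitution fixes the default [PTrue]. *)
have nthms k : nth PTrue ms k = fsubst (restrict n) (nth PTrue ls k).
  have [kls|kls] := ltnP k (size ls); first by rewrite (nth_map PTrue).
  by rewrite !nth_default ?sms.
have ms_below A : List.In A ms -> fvars_below n A.
  by move=> inA; have [B _ ->] := In_mapP inA; apply: fvars_below_restrict.
have ms_step k : (k < size ms)%N -> exists r s, [/\ List.In r (frege_rules P),
    forall p, fvars_below n (s p), fsubst s r.2 = nth PTrue ms k &
    forall A, List.In A r.1 -> exists2 j, (j < k)%N & nth PTrue ms j = fsubst s A].
  rewrite sms => /deriv[//|[r [s [inr [eqk prem]]]]].
  exists r, (fun i => fsubst (restrict n) (s i)); split=> //.
  - by move=> p; apply: fvars_below_restrict.
  - by rewrite -fsubst_comp eqk nthms.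
  - by move=> A /prem[j [jk eqj]]; exists j; rewrite // nthms eqj fsubst_comp.
have lastms : last PTrue ms = T.
  by rewrite -nth_last nthms sms nth_last lsT fsubst_restrict.
have ms0 : ms <> [::] by rewrite /ms; case: (ls) ls0.
have [||Phi [sPhi vPhi zPhi ePhi]] :=
  certified_one comm_ax bool_ax (@frege_sound P) ms_below ms_step ms0.
- by [].
- by rewrite lastms.
exists Phi; split.
  apply: leq_trans sPhi _.
  by rewrite proof_size_restrict expnMn mulnA.
split; first exact: vPhi.
(* A certificate is known by its values in all algebras; these determine the two required identities
   of the free algebra. *)
split; apply: nceq_ncev => A s; rewrite ncev_subst.
  rewrite /= scale0r -(zPhi A s); apply: eq_ncev => -[i|j] //=.
  by rewrite scale0r.
by rewrite -(ePhi A s); apply: eq_ncev => -[i|j].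
Qed.

Theorem theorem1p4 (P : frege_system) :
  nc_ips_psimulates rat P /\
  (forall q : nat, prime q -> nc_ips_psimulates 'F_q P).
Proof.
split=> [|q _]; exact: frege_polynomially_simulated.
Qed.
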